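(* Let $X$ be a set with $|X|\ge 3$. For every integer $n\ge 3$, we have $\mathcal{F}^n_{n-1}\setminus\mathcal{F}^n_1\neq\varnothing$ if and only if $|X|\ge c_{n-1}$.
   Context: An operation $F\colon X^n\to X$ is associative if $F(x_1,\ldots,x_{i-1},F(x_i,\ldots,x_{i+n-1}),x_{i+n},\ldots,x_{2n-1})=F(x_1,\ldots,x_i,F(x_{i+1},\ldots,x_{i+n}),x_{i+n+1},\ldots,x_{2n-1})$ for all $x_1,\ldots,x_{2n-1}\in X$ and $1\le i\le n-1$. For $k\in\{1,\ldots,n\}$, $\mathcal{F}^n_k$ is the class of associative operations $F\colon X^n\to X$ such that $F(x_1,\ldots,x_n)\in\{x_1,\ldots,x_n\}$ whenever at least $k$ of the components $x_1,\ldots,x_n$ are equal to each other. The exponent of a group is the smallest integer $r\ge 1$ (if any) such that the $r$-th power of every element is the neutral element. For any integer $m\ge 2$, $c_m$ denotes the cardinality of the smallest Abelian group with at least three elements whose exponent divides $m$. *)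

(* Defs.v *)
From mathcomp Require Import all_boot all_order all_algebra all_fingroup all_solvable.
From mathcomp Require Import all_classical.

Set Implicit Arguments.
Unset Strict Implicit.
Unset Printing Implicit Defensive.

Local Open Scope classical_set_scope.

Section NaryOperations.
Variables (X : Type) (n : nat).
Implicit Types (F : n.-tuple X -> X) (x : nat -> X) (k i : nat).

(* [nested F x i] is
     F(x_0, ..., x_(i-1), F(x_i, ..., x_(i+n-1)), x_(i+n), ..., x_(2n-2)),
   with components numbered from 0. For [i < n] only the first [2n-1] terms of
   the sequence [x] occur, so letting [x] range over sequences amounts to letting
   it range over [X^(2n-1)]. *)
Definition nested F x i : X :=
  F [tuple (if j < i then x j
            else if j == i :> nat then F [tuple x (i + l) | l < n]
            else x (j + n).-1) | j < n].

Definition associative_op F : Prop :=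
  forall x i, i.+1 < n -> nested F x i = nested F x i.+1.

Definition has_equal_components k (t : n.-tuple X) : Prop :=
  exists2 A : {set 'I_n}, k <= #|A| &
    forall i j : 'I_n, i \in A -> j \in A -> tnth t i = tnth t j.

Definition Fclass k : set (n.-tuple X -> X) :=
  [set F | associative_op F /\
           forall t, has_equal_components k t -> exists i : 'I_n, F t = tnth t i].

End NaryOperations.
Arguments Fclass X n k : clear implicits.

(* Finite groups suffice: for [2 <= m] there is always a finite group with the
   required properties, e.g. (Z/m)^2, so the smallest one is finite. *)
Definition abelian_exponent_card (m k : nat) : Prop :=
  exists (gT : finGroupType) (G : {group gT}),
    [/\ abelian G, #|G| = k, 3 <= #|G| & exponent G %| m].

(* The value for [m < 2] is irrelevant. *)
Definition min_abelian_card (m : nat) : nat :=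
  xget 0 [set k | abelian_exponent_card m k /\
                  forall l, abelian_exponent_card m l -> k <= l].

Lemma min_abelian_cardP (m : nat) : 2 <= m ->
  abelian_exponent_card m (min_abelian_card m) /\
  forall l, abelian_exponent_card m l -> min_abelian_card m <= l.
Proof.
move=> m2.
have exb : exists k, `[< abelian_exponent_card m k >].
  exists (m * m); apply/asboolP.
  exists ('Z_m * 'Z_m)%type, [set: 'Z_m * 'Z_m]%G.
  have cardG : #|[set: 'Z_m * 'Z_m]%SET| = m * m.
    by rewrite cardsT card_prod card_ord Zp_cast.
  split=> //.
  - apply/centsP => -[a b] _ [c d] _.
    by rewrite /commute /mulg /= /mulg /=; congr (_, _); apply: Zp_mulgC.
  - by rewrite cardG (leq_trans _ (leq_mul m2 m2)).
  - apply/exponentP => -[a b] _.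
    have E j : ((a, b) ^+ j = (a ^+ j, b ^+ j))%g.
      by elim: j => // j IH; rewrite !expgS IH.
    rewrite E !Zp_expg; congr (_, _); apply: val_inj => /=;
      by apply/eqP/dvdn_mull; rewrite Zp_cast.
rewrite /min_abelian_card.
case: (ex_minnP exb) => k /asboolP hk kmin.
apply: (@xgetPex _ 0 [set k | abelian_exponent_card m k /\
  forall l, abelian_exponent_card m l -> k <= l]).
by exists k; split=> // l hl; apply: kmin; apply/asboolP.
Qed.

(* Main.v *)
Require Import Defs.
From HB Require Import structures.
From mathcomp Require Import all_boot all_order all_algebra all_fingroup all_solvable.
From mathcomp Require Import finmap all_classical.
From mathcomp Require Import zify.

Set Implicit Arguments.
Unset Strict Implicit.
Unset Printing Implicit Defensive.

(* Let m = n - 1. An n-ary semigroup X embeds in a monoid M so that F becomes the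
   n-fold product. If F belongs to the class with k = n - 1, then
   x^i y x^(m-i) is x or y for all x, y in X; in particular x^m is an idempotent
   acting as an identity on x. When x^m and y^m differ, one of x, y absorbs the
   other, so xy is x^2 or y^2; hence every product of elements of X equals a
   product of some of them sharing the same m-th power. When x^m = y^m = e, the
   elements x and y commute, and {x a^(m-1) : x^m = e}, for any a with a^m = e,
   is an Abelian group of exponent dividing m. If all such groups had at most two
   elements, F would thus be quasitrivial. Conversely, an Abelian group embedded
   in X, together with left zeros outside it, makes X a monoid whose n-fold
   product is the required operation. *)

Local Open Scope classical_set_scope.
Local Open Scope card_scope.

(** * An n-ary operation applied to words *)

Section OperationsOnSequences.
Variables (X : Type) (n : nat) (F : n.-tuple X -> X) (x0 : X).

(** Words avoid casts between tuple lengths; [x0] pads words shorter than [n], and letters after the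
    first [n] are ignored. *)
Definition on_seq (w : seq X) : X := F [tuple nth x0 w j | j < n].

Lemma on_seq_tuple (t : n.-tuple X) : on_seq t = F t.
Proof.
by congr F; apply: eq_from_tnth => j; rewrite tnth_mktuple (tnth_nth x0).
Qed.

Lemma nested_on_seq (x : nat -> X) i : i < n ->
  nested F x i =
    on_seq (mkseq x i ++ on_seq (mkseq (fun l => x (i + l)) n)
              :: mkseq (fun l => x (i + n + l)) (n - i.+1)).
Proof.
move=> ltin; congr F; apply: eq_from_tnth => j; rewrite !tnth_mktuple.
rewrite nth_cat size_mkseq; case: (ltngtP j i) => [ltji|ltij|->].
- by rewrite nth_mkseq.
- have -> : j - i = (j - i.+1).+1 by lia.
  rewrite /= nth_mkseq; last by have := ltn_ord j; lia.
  by congr x; lia.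
- rewrite subnn /=; congr F; apply: eq_from_tnth => l.
  by rewrite !tnth_mktuple nth_mkseq.
Qed.

Lemma mkseq_split (x : nat -> X) i : i < n ->
  mkseq x i ++ mkseq (fun l => x (i + l)) n
    ++ mkseq (fun l => x (i + n + l)) (n - i.+1) = mkseq x (n + n.-1).
Proof.
move=> ltin.
have mkseqD a b : mkseq x a ++ mkseq (fun l => x (a + l)) b = mkseq x (a + b).
  by rewrite /mkseq iotaD map_cat -(addnC a) iotaDl -map_comp.
by rewrite catA !mkseqD; congr mkseq; lia.
Qed.

(** Both sides bracket the same word of length 2n-1, and associativity moves the inner bracket to
    position 0. *)
Lemma associative_on_seq (u t v u' t' v' : seq X) : associative_op F ->
  size t = n -> size t' = n ->
  size u + size v = n.-1 -> size u' + size v' = n.-1 -> 0 < n ->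
  u ++ t ++ v = u' ++ t' ++ v' ->
  on_seq (u ++ on_seq t :: v) = on_seq (u' ++ on_seq t' :: v').
Proof.
move=> Fassoc st st' suv suv' n0 eqw.
have nested0 x i : i < n -> nested F x i = nested F x 0.
  by elim: i => // i IH lt; rewrite -Fassoc // IH // ltnW.
have E (p q r : seq X) : size q = n -> size p + size r = n.-1 ->
    on_seq (p ++ on_seq q :: r) = nested F (nth x0 (p ++ q ++ r)) (size p).
  move=> sq spr; rewrite nested_on_seq; last by lia.
  congr on_seq; congr (_ ++ (_ :: _)).
  - apply: (@eq_from_nth _ x0); rewrite ?size_mkseq // => j lt.
    by rewrite nth_mkseq // nth_cat lt.
  - congr on_seq; apply: (@eq_from_nth _ x0); rewrite ?size_mkseq // => j lt.
    rewrite nth_mkseq -?sq // nth_cat ltnNge leq_addr /= addKn nth_cat.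
    by rewrite lt.
  - apply: (@eq_from_nth _ x0); rewrite ?size_mkseq; first by lia.
    move=> j lt; rewrite nth_mkseq; last by lia.
    rewrite nth_cat ltnNge -addnA leq_addr /= addKn nth_cat sq ltnNge leq_addr.
    by rewrite /= addKn.
by rewrite !E // eqw !nested0 //; lia.
Qed.

End OperationsOnSequences.

(** Wherever the inner bracket stands, the nested value is the product of all 2n-1 letters. *)
Lemma prod_associative (M : monoidType) (n : nat) :
  associative_op (fun t : n.-tuple M => (\prod_(x <- t) x)%g).
Proof.
set F := fun t : n.-tuple M => _.
have E w : size w = n -> on_seq F 1%g w = (\prod_(x <- w) x)%g.
  move=> sw; rewrite /on_seq /F; congr bigop.
  rewrite -[RHS](mkseq_nth 1%g) sw /mkseq -val_enum_ord -map_comp.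
  by apply: eq_map.
have N x i : i < n -> nested F x i = (\prod_(y <- mkseq x (n + n.-1)) y)%g.
  move=> ltin; rewrite (nested_on_seq _ 1%g) // !E ?size_mkseq //; last first.
    by rewrite size_cat /= !size_mkseq; lia.
  by rewrite -(mkseq_split _ ltin) !big_cat big_cons.
by move=> x i lt; rewrite !N // ltnW.
Qed.

(** * Embedding an n-ary semigroup in a monoid *)

Definition transf (A : Type) : Type := A -> A.

HB.instance Definition _ (A : Type) := gen_eqMixin (transf A).
HB.instance Definition _ (A : Type) := gen_choiceMixin (transf A).
(** Maps compose from left to right, so that a product of operators [remember x] prepends its
    letters in the order of the factors. *)
HB.instance Definition _ (A : Type) :=
  @isMonoid.Build (transf A) (fun a b x => b (a x)) id
    (fun _ _ _ => erefl) (fun _ => erefl) (fun _ => erefl).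

(* A state is a word of at most [n.-1] letters waiting to be completed. *)
Section Evaluation.
Variables (X : Type) (n : nat) (F : n.-tuple X -> X) (x0 : X).
Hypotheses (Fassoc : associative_op F) (n2 : 1 < n).
Implicit Types (s t u v w : seq X).
Let f := on_seq F x0.

Definition push s x := if size s == n.-1 then [:: f (rcons s x)] else rcons s x.

(** One letter remains exactly for nonempty words of length 1 modulo n-1. *)
Definition eval w : option X :=
  if foldl push [::] w is [:: x] then Some x else None.

(** No continuation separates the two states; short states must coincide because [eval] reads them
    directly. *)
Let st_eqv s1 s2 :=
  [/\ size s1 = size s2, size s1 <= n.-1, size s1 <= 1 -> s1 = s2 &
      forall v, size s1 + size v = n -> f (s1 ++ v) = f (s2 ++ v)].

Let st_eqv_push s1 s2 x : st_eqv s1 s2 -> st_eqv (push s1 x) (push s2 x).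
Proof.
move=> [ss sn s1E fE]; rewrite /push -ss; case: eqP => sm.
  rewrite -!cats1 fE //=; first by split=> //=; lia.
  by rewrite /= sm; lia.
split; rewrite ?size_rcons ?ss //; first by lia.
- by move=> ?; rewrite s1E //; lia.
- by move=> v sv; rewrite !cat_rcons fE //=; lia.
Qed.

Let size_push s x : size s <= n.-1 -> size (push s x) <= n.-1.
Proof. by rewrite /push; case: eqP => /=; rewrite ?size_rcons; lia. Qed.

Let foldl_push s t : size s + size t <= n.-1 -> foldl push s t = s ++ t.
Proof.
elim: t s => [|y t IH] s /= st; first by rewrite cats0.
rewrite /push; case: eqP => [|_]; first by lia.
by rewrite IH ?size_rcons ?cat_rcons //; lia.
Qed.

Let st_eqv_foldl s t : size s <= n.-1 -> size t = n ->
  st_eqv (foldl push s t) (push s (f t)).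
Proof.
move=> ss st.
(* Here [t1] fills the state to n-1 letters, [y] makes it collapse, and [t2] follows the collapsed
   letter. *)
have [t1 [y [t2 [tE st1 st2]]]] : exists t1 y t2,
    [/\ t = t1 ++ y :: t2, size t1 = n.-1 - size s & size t2 = size s].
  exists (take (n.-1 - size s) t); have := cat_take_drop (n.-1 - size s) t.
  have : size (drop (n.-1 - size s) t) = (size s).+1 by rewrite size_drop; lia.
  case: (drop _ t) => // y t2 [st2] tE; exists y, t2.
  by rewrite tE size_takel; [split | lia].
have -> : foldl push s t = foldl push [:: f (s ++ rcons t1 y)] t2.
  rewrite tE foldl_cat [foldl push s t1]foldl_push; last by lia.
  rewrite /= {2}/push size_cat; case: eqP => [_|]; last by lia.
  by rewrite rcons_cat.
have assoc v : (size s + size v).+1 = n ->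
    f (f (s ++ rcons t1 y) :: t2 ++ v) = f (s ++ f t :: v).
  move=> sv; apply: (@associative_on_seq _ _ _ x0 [::]); rewrite //= ?tE;
    by [rewrite -!catA cat_rcons | rewrite ?size_cat ?size_rcons; lia].
(* If [s] is full, [f t] collapses it at once, and the last letter of [t2] causes a second collapse
   on the other side. *)
case: (eqVneq (size s) n.-1) => sm.
  case/lastP: t2 st2 tE assoc => [|t2 z]; first by rewrite /=; lia.
  rewrite size_rcons => st2 tE assoc.
  rewrite foldl_rcons foldl_push; last by rewrite /=; lia.
  rewrite /push sm eqxx /= st2 sm eqxx.
  have := assoc [::]; rewrite cats0 cats1 => -> //=; last by rewrite sm; lia.
  by split=> //=; lia.
rewrite foldl_push; last by rewrite /=; lia.
rewrite /push (negPf sm).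
split; rewrite ?size_rcons /= ?st2 //; first by lia.
- move=> s0; have {}s0 : size s = 0 by lia.
  move: st2; rewrite s0 => /size0nil t2E; move/size0nil: s0 => sE.
  by rewrite tE t2E sE /= cats1.
- by move=> v sv; rewrite cat_rcons; apply: assoc; lia.
Qed.

(** These are the functions on words that respect replacing [n] consecutive letters by their
    value. *)
Definition stable (g : seq X -> option X) :=
  forall u t v, size t = n -> g (u ++ t ++ v) = g (u ++ f t :: v).

Lemma stable_eval : stable eval.
Proof.
move=> u t v st; rewrite /eval !foldl_cat.
have su : size (foldl push [::] u) <= n.-1.
  have : size (@nil X) <= n.-1 by [].
  by elim: u [::] => //= y u IH s /(size_push y)/IH.
have : st_eqv (foldl push (foldl push [::] u) t)
              (push (foldl push [::] u) (f t)) by exact: st_eqv_foldl.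
rewrite /=; move: (foldl push _ t) (push _ _) => s1 s2.
elim: v s1 s2 => [|y v IH] s1 s2 /= E; last exact/IH/st_eqv_push.
case: E => ss _ sE _; case: (leqP (size s1) 1) => [/sE -> //|].
by case: s1 s2 ss {sE} => [|? [|? ?]] [|? [|? ?]].
Qed.

Lemma eval1 x : eval [:: x] = Some x.
Proof. by rewrite /eval /= /push /=; case: eqP => //; lia. Qed.

(** Functions that are not stable go to a constant, since the product formula for [F] must hold at
    every argument. *)
Let remember (x : X) : transf (seq X -> option X) :=
  fun g => if `[< stable g >] then fun w => g (x :: w) else fun=> None.

Lemma covering_monoid : exists (S : monoidType) (i : X -> S),
  injective i /\ forall t : n.-tuple X, i (F t) = (\prod_(x <- t) i x)%g.
Proof.
exists (transf (seq X -> option X)), remember; split=> [x y|t].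
  (* Acting on [eval] and reading at the empty word recovers the letter. *)
  move=> /(congr1 (fun a => a eval [::])); rewrite /remember.
  by case: asboolP => [_|/(_ stable_eval)//]; rewrite !eval1 => -[].
have prodE w g : 0 < size w -> (\prod_(x <- w) remember x)%g g =
    if `[< stable g >] then fun v => g (w ++ v) else fun=> None.
  elim: w g => // x w IH g _; rewrite big_cons /mulg /= /remember -/remember.
  case: (posnP (size w)) => [/size0nil -> | w0]; first by rewrite big_nil.
  rewrite (IH _ w0); case: (asboolP (stable g)) => sg; last first.
    by case: ifP.
  case: asboolP => // -[]; move=> u v r; exact: (sg (x :: u)).
apply: funext => g; rewrite prodE; last first.
  by rewrite size_tuple; lia.
rewrite /remember; case: asboolP => // sg; apply: funext => v.
by rewrite -(on_seq_tuple F x0 t); exact/esym/(sg [::])/size_tuple.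
Qed.

End Evaluation.

(** * Monoids in which x^k y x^(m-k) is x or y on a given subset *)

Section NearIdempotentMonoid.
Local Open Scope group_scope.
Variables (M : monoidType) (P : set M) (m : nat).
Hypothesis m2 : 1 < m.
Hypothesis near_idem : forall a b k, P a -> P b -> k <= m ->
  a ^+ k * b * a ^+ (m - k) = a \/ a ^+ k * b * a ^+ (m - k) = b.
Implicit Types (a b c : M) (w u : seq M).

Let near_idemr a b : P a -> P b -> a ^+ m * b = a \/ a ^+ m * b = b.
Proof.
by move=> Pa Pb; have := near_idem Pa Pb (leqnn m); rewrite subnn mulg1.
Qed.

Let near_ideml a b : P a -> P b -> b * a ^+ m = a \/ b * a ^+ m = b.
Proof.
by move=> Pa Pb; have := near_idem Pa Pb (leq0n m); rewrite subn0 mul1g.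
Qed.

Lemma near_idem_mulXl a : P a -> a ^+ m * a = a.
Proof. by move=> Pa; have [] := near_idemr Pa Pa. Qed.

Lemma near_idem_mulXr a : P a -> a * a ^+ m = a.
Proof. by move=> Pa; have [] := near_ideml Pa Pa. Qed.

Let mulXK a b : a ^+ m * b = b -> a ^+ m * b ^+ m = b ^+ m.
Proof.
by move=> ab; case: m m2 ab => // k _ ab; rewrite [b ^+ _]expgS mulgA ab.
Qed.

Lemma near_idem_mulXX a : P a -> a ^+ m * a ^+ m = a ^+ m.
Proof. by move=> Pa; apply/mulXK/near_idem_mulXl. Qed.

(** Let a^m b = b. Then a b^m = a would give a^m = a^m b^m = b^m; so a b^m = b, and a b = a b^m b =
    b b. *)
Lemma near_idem_absorb a b : P a -> P b -> a ^+ m <> b ^+ m ->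
  (a ^+ m * b = a) \/ (a * b = b * b).
Proof.
move=> Pa Pb neq; have [|ab] := near_idemr Pa Pb; [by left | right].
have [ba|ba] := near_ideml Pb Pa.
  by rewrite -{1}(near_idem_mulXl Pb) mulgA ba.
case: neq; rewrite -(mulXK ab); case: m m2 ba => // k _ ba.
by rewrite [a ^+ _]expgSr -mulgA ba.
Qed.

(** If a^m c = a, then a c = a a^m c = a a. Otherwise a^m c = c, so a^m fixes c^m = b^m, whence a =
    a^m b = b. *)
Lemma near_idem_absorb_class a b c : P a -> P c -> a ^+ m <> b ^+ m ->
  P b -> b ^+ m = c ^+ m -> a ^+ m * b = a -> a * c = a * a.
Proof.
move=> Pa Pc neq Pb bc ab; have [ac|ac] := near_idemr Pa Pc.
  by rewrite -{1}(near_idem_mulXr Pa) -mulgA ac.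
case: neq; congr (_ ^+ m); rewrite -ab -{1}(near_idem_mulXl Pb) bc mulgA.
by rewrite (mulXK ac) -bc near_idem_mulXl.
Qed.

(** A new letter [x] shares the m-th power of the reduced tail, or absorbs the tail, or is absorbed
    and replaced by its head [c]. The length is kept so that a constant [u] is a power of known
    exponent. *)
Lemma near_idem_prod w : w != [::] -> {in w, forall x, P x} ->
  exists u, [/\ size u = size w, {subset u <= w},
    \prod_(x <- u) x = \prod_(x <- w) x & {in u &, forall a b, a ^+ m = b ^+ m}].
Proof.
elim: w => // x w IH _ Pw.
have Px : P x by apply: Pw; rewrite mem_head.
have Pin y : y \in w -> P y by move=> yw; apply: Pw; rewrite in_cons yw orbT.
case: (eqVneq w [::]) => [->|/IH/(_ Pin)[u [su uw prodE uclass]]].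
  by exists [:: x]; split=> // a b; rewrite !mem_seq1 => /eqP-> /eqP->.
case: u su uw prodE uclass => [|c u] su uw prodE uclass.
  have /size0nil w0 : size w = 0 by rewrite -su.
  by exists [:: x]; rewrite w0; split=> // a b; rewrite !mem_seq1 => /eqP-> /eqP->.
have cw : c \in w by rewrite uw ?mem_head.
have [xc|xc] := EM (x ^+ m = c ^+ m).
  exists (x :: c :: u); split; first by rewrite /= -su.
  - by move=> y; rewrite !in_cons => /orP[->//|/uw ->]; rewrite orbT.
  - by rewrite big_cons prodE big_cons.
  - have cE a : a \in x :: c :: u -> a ^+ m = c ^+ m.
      by rewrite in_cons => /orP[/eqP->//|au]; apply: uclass; rewrite ?mem_head.
    by move=> a b /cE -> /cE ->.
have Pc := Pin _ cw.
have [xcx|xcc] := near_idem_absorb Px Pc xc.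
  exists (nseq (size w).+1 x); split; first by rewrite size_nseq.
  - by move=> y; rewrite mem_nseq => /eqP ->; rewrite mem_head.
  - rewrite [RHS]big_cons -prodE -su.
    (* Absorbing one letter of the class forces [x] to absorb the whole tail. *)
    have : {in c :: u, forall y, x * y = x * x}.
      move=> y yu; apply: (near_idem_absorb_class Px (Pin _ (uw _ yu)) xc Pc) => //.
      by apply: uclass; rewrite ?mem_head.
    elim: (c :: u) => [|y v IHv] xv /=; first by rewrite big_cons !big_nil.
    rewrite /= in IHv; rewrite big_cons IHv; last first.
      by move=> z zv; apply: xv; rewrite in_cons zv orbT.
    by rewrite big_cons !mulgA (xv y) ?mem_head.
  - by move=> a b; rewrite !mem_nseq /= => /eqP-> /eqP->.
exists (c :: c :: u); split; first by rewrite /= -su.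
- move=> y; rewrite in_cons => /orP[/eqP->|/uw]; last by rewrite in_cons orbC => ->.
  by rewrite in_cons cw orbT.
- by rewrite [RHS]big_cons -prodE !big_cons !mulgA xcc.
- have cE a : a \in c :: c :: u -> a ^+ m = c ^+ m.
    by rewrite in_cons => /orP[/eqP->//|au]; apply: uclass; rewrite ?mem_head.
  by move=> a b /cE -> /cE ->.
Qed.

(** Take k = m-1. If a^(m-1) b a = a, then b a = a a, so b = b a^m = a a^m = a. If it is b, then a b
    = a^m b a = b a. *)
Lemma near_idem_commute a b : P a -> P b -> a ^+ m = b ^+ m -> commute a b.
Proof.
move=> Pa Pb ab.
have mE c : c ^+ m = c * c ^+ m.-1 by rewrite -expgS prednK // ltnW.
have := near_idem Pa Pb (leq_pred m).
rewrite (_ : m - m.-1 = 1%N) ?expg1; last by lia.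
case=> E.
  have ba : b * a = a * a.
    by rewrite -{1}(near_idem_mulXl Pb) -ab mE -!mulgA [X in _ * X]mulgA E.
  suff -> : a = b by [].
  rewrite -[RHS](near_idem_mulXr Pb) -ab -[LHS](near_idem_mulXr Pa).
  by rewrite mE !mulgA ba.
by rewrite /commute -[in LHS]E !mulgA -mE ab near_idem_mulXl.
Qed.

(** The letters commute, so the power distributes over the product, and e is idempotent. *)
Lemma near_idem_prod_class e u : u != [::] ->
  {in u, forall x, P x /\ x ^+ m = e} -> (\prod_(x <- u) x) ^+ m = e.
Proof.
elim: u => // x u IH _ xu; have [Px xe] := xu x (mem_head _ _).
have {}xu : {in u, forall x, P x /\ x ^+ m = e}.
  by move=> y yu; apply: xu; rewrite in_cons yu orbT.
rewrite big_cons; have [->|/IH/(_ xu) ue] := eqVneq u [::].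
  by rewrite big_nil mulg1.
rewrite expgMn ?xe ?ue -?xe ?near_idem_mulXX //.
rewrite big_seq; apply: commute_prod => y /xu[Py ye].
by apply: near_idem_commute; rewrite // xe ye.
Qed.

End NearIdempotentMonoid.

(** * Finite groups built from a law, possibly inside a monoid *)

Section GroupOfLaw.
Variables (T : finType) (mul : T -> T -> T) (one : T) (inv : T -> T).

(** The axioms are arguments of this alias of [T], so the group structure can attach to it. *)
Definition law_group of associative mul & left_id one mul
  & left_inverse one inv mul : predArgType := T.

Hypotheses (mulA : associative mul) (mul1 : left_id one mul).
Hypothesis mulV : left_inverse one inv mul.

HB.instance Definition _ := Finite.on (law_group mulA mul1 mulV).
HB.instance Definition _ :=
  Finite_isGroup.Build (law_group mulA mul1 mulV) mulA mul1 mulV.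

Lemma card_law_group : #|law_group mulA mul1 mulV| = #|T|.
Proof.
by apply: (@bij_eq_card (law_group mulA mul1 mulV) T id); exists id.
Qed.

End GroupOfLaw.

(** The image of [g] is a group whose neutral element [g z] may differ from 1; inverses are powers
    of exponent m-1. *)
Lemma embedded_abelian_exponent_card (M : monoidType) (T : finType) (g : T -> M)
    (z : T) (m : nat) :
  0 < m -> injective g -> 2 < #|T| ->
  (forall a, g z * g a = g a)%g -> (forall a b, exists c, g a * g b = g c)%g ->
  (forall a b, commute (g a) (g b)) -> (forall a, g a ^+ m = g z)%g ->
  abelian_exponent_card m #|T|.
Proof.
move=> m0 g_inj T2 gz gclosed gC gX.
have [mul mulE] : exists mul : T -> T -> T,
    forall a b, (g a * g b = g (mul a b))%g.
  by have [f fE] := choice (fun ab : T * T => gclosed ab.1 ab.2);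
     exists (fun a b => f (a, b)) => a b; rewrite -fE.
pose inv a := iter m.-1 (mul a) z.
have gM k a : g (iter k (mul a) z) = (g a ^+ k * g z)%g.
  by elim: k => [|k IH] /=; rewrite ?mul1g // -mulE IH mulgA -expgS.
have mulA : associative mul.
  by move=> a b c; apply: g_inj; rewrite -!mulE mulgA.
have mul1 : left_id z mul by move=> a; apply: g_inj; rewrite -mulE.
have mulV : left_inverse z inv mul.
  move=> a; apply: g_inj; rewrite -mulE gM -mulgA gz -expgSr prednK //.
exists (law_group mulA mul1 mulV), [set: law_group mulA mul1 mulV]%G.
split; rewrite ?cardsT ?card_law_group //.
- by apply/centsP => a _ b _; apply: g_inj; rewrite -!mulE; apply: gC.
- apply/exponentP => a _; apply: g_inj.
  have -> : (a ^+ m)%g = iter m (mul a) z.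
    by elim: (m) => // k IH; rewrite expgS IH.
  by rewrite gM gX gz.
Qed.

(** * From an operation to an Abelian group *)

Lemma prod_nseq (M : monoidType) (X : Type) (i : X -> M) k x :
  (\prod_(y <- nseq k x) i y = i x ^+ k)%g.
Proof.
by elim: k => [|k IH] /=; rewrite ?big_nil // big_cons IH expgS.
Qed.

Lemma all_but_one_equal (X : Type) n k (x y : X) (t : n.-tuple X) :
  tval t = nseq k x ++ y :: nseq (n.-1 - k) x -> k <= n.-1 -> 0 < n ->
  has_equal_components n.-1 t.
Proof.
move=> tE kn n0; have kltn : k < n by lia.
exists [set~ Ordinal kltn]%SET; first by rewrite cardsC1 card_ord.
have E j : j \in [set~ Ordinal kltn]%SET -> tnth t j = x.
  rewrite !inE -val_eqE /= (tnth_nth x) tE => jk.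
  rewrite nth_cat size_nseq nth_nseq; case: ltnP => // kj.
  have -> : j - k = (j - k.+1).+1 by lia.
  by rewrite /= nth_nseq if_same.
by move=> j l /E -> /E ->.
Qed.

Lemma Fclass_near_idem (X : Type) n (F : n.-tuple X -> X) (M : monoidType)
    (i : X -> M) :
  (forall t, i (F t) = \prod_(x <- t) i x)%g -> 0 < n -> Fclass X n n.-1 F ->
  forall a b k, range i a -> range i b -> k <= n.-1 ->
    (a ^+ k * b * a ^+ (n.-1 - k) = a \/ a ^+ k * b * a ^+ (n.-1 - k) = b)%g.
Proof.
move=> iF n0 [_ Fcons] _ _ k [x _ <-] [y _ <-] kn.
have size_w : size (nseq k x ++ y :: nseq (n.-1 - k) x) == n.
  by rewrite size_cat /= !size_nseq; lia.
have [j Fj] := Fcons _ (@all_but_one_equal _ _ k x y (Tuple size_w) erefl kn n0).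
have := iF (Tuple size_w); rewrite /= big_cat big_cons !prod_nseq /= mulgA => <-.
rewrite Fj (tnth_nth x) /= nth_cat size_nseq nth_nseq.
case: ltnP => _; first by left.
case: (j - k) => [|l] /=; first by right.
by rewrite nth_nseq if_same; left.
Qed.

Lemma Fclass_abelian_exponent_card (X : Type) n (F : n.-tuple X -> X) :
  2 < n -> finite_set [set: X] -> Fclass X n n.-1 F -> ~ Fclass X n 1 F ->
  exists2 k, abelian_exponent_card n.-1 k & `I_k #<= [set: X].
Proof.
(* Classical choice supplies the [choiceType] structure needed for finite sets. *)
elim/Pchoice: X => X in F *.
move=> n2 Xfin FF notF1; have [Fassoc _] := FF.
have [t tF] : exists t, forall j, F t <> tnth t j.
  apply: contrapT => H; apply: notF1; split=> // t _.
  by apply: contrapT => H'; apply: H; exists t => j E; apply: H'; exists j.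
have n0 : 0 < n by lia.
have m2 : 1 < n.-1 by lia.
pose x0 := tnth t (Ordinal n0).
have [M [i [i_inj iF]]] := covering_monoid x0 Fassoc (ltnW n2).
have near := Fclass_near_idem iF n0 FF.
have Ri x : range i (i x) by exists x.
pose e x := (i x ^+ n.-1)%g.
have iC x y : e x = e y -> commute (i x) (i y).
  by apply: near_idem_commute near _ _ _ _.
have [[a [b [c [ab ac]] [neq_ab neq_ac neq_bc]]]|small] := EM (exists a b c,
  [/\ e a = e b, e a = e c & [/\ a <> b, a <> c & b <> c]]); last first.
  (* If no class has three elements, reduce [t] to a word [u] in one class, which also contains F t.
     A constant [u] has value y^n = y, a letter of [t]; otherwise two letters of [u] and F t are
     three elements. *)
  exfalso; have [|_ /mapP[x _ ->]|u [su uw prodE uclass]] :=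
      near_idem_prod m2 near (w := map i t).
  - by rewrite -size_eq0 size_map size_tuple; lia.
  - by exists x.
  move: prodE; rewrite big_map -iF => prodE.
  case: u su uw prodE uclass => [|y v] su uw prodE uclass.
    by move: su; rewrite size_map size_tuple /=; lia.
  have ue : {in y :: v, forall z, range i z /\ z ^+ n.-1 = y ^+ n.-1}%g.
    move=> z zv; split; last by apply: uclass; rewrite ?mem_head.
    by have /mapP[x _ ->] := uw _ zv.
  have /mapP[a at_ yE] := uw _ (mem_head _ _).
  have eFt : e (F t) = e a.
    by rewrite /e -prodE -yE; apply: (near_idem_prod_class m2 near).
  have Ft_neq x : x \in t -> x <> F t by case/tnthP => j -> /esym/tF.
  have [vy|] := boolP (all (pred1 y) v).
    apply: (Ft_neq a at_); apply: i_inj; rewrite -prodE big_cons.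
    rewrite (all_pred1P _ _ vy) (prod_nseq id) /= -expgS.
    move: su; rewrite size_map size_tuple /= => ->.
    by rewrite -(prednK n0) expgS yE (near_idem_mulXr near).
  move=> /allPn[y' y'v /= /eqP neq].
  have y'u : y' \in y :: v by rewrite in_cons y'v orbT.
  have /mapP[b bt y'E] := uw _ y'u.
  apply: small; exists a, b, (F t); split => //; last first.
    by split; [move=> ab; apply: neq; rewrite yE y'E ab | exact: Ft_neq..].
  by rewrite /e -yE -y'E; apply: uclass; rewrite ?mem_head.
pose C := [set x | e x = e a].
have Cfin : finite_set C by apply: sub_finite_set Xfin.
have inC (x : fset_set C) : e (val x) = e a.
  by have := valP x; rewrite in_fset_set // inE.
have toC x : e x = e a -> exists y : fset_set C, val y = x.
  move=> xa; have xC : x \in fset_set C by rewrite in_fset_set // inE.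
  by exists [` xC]%fset.
exists #|{: fset_set C}|; last first.
  have [k Ck] := Cfin; rewrite -cardfE (card_fset_set Ck) -(card_le_eql Ck).
  exact: card_leT.
(* The class is closed under n-fold products; the factor a^(m-1) yields a set closed under binary
   ones, and multiplying by a undoes it. *)
pose g (x : fset_set C) := (i (val x) * i a ^+ n.-1.-1)%g.
have mE x : (i x ^+ n.-1 = i x * i x ^+ n.-1.-1)%g.
  by rewrite -expgS prednK // ltnW.
have mEr x : (i x ^+ n.-1 = i x ^+ n.-1.-1 * i x)%g.
  by rewrite -expgSr prednK // ltnW.
have [z zE] := toC a erefl.
have gzE : g z = e a by rewrite /g zE -mE.
apply: (embedded_abelian_exponent_card (g := g) (z := z)); first by lia.
- move=> x y gxy; apply/val_inj/i_inj.
  have gK w : (g w * i a = i (val w))%g.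
    by rewrite /g -mulgA -mEr -/(e a) -(inC w) (near_idem_mulXr near).
  by rewrite -gK gxy gK.
- have [[b' bE] [c' cE]] := (toC b (esym ab), toC c (esym ac)).
  apply/card_gt2P; exists z, b', c'; split=> //.
  split; apply/eqP => /(congr1 val); rewrite ?zE ?bE ?cE //.
  exact: nesym.
- by move=> x; rewrite gzE /g mulgA -(inC x) (near_idem_mulXl near).
- move=> x y.
  (* g x g y = g (x a^(m-1) y), where x a^(m-1) y is the n-fold product of [w]. *)
  pose w := val x :: rcons (nseq n.-1.-1 a) (val y).
  have size_w : size w == n by rewrite /= size_rcons size_nseq; lia.
  have iw : i (F (Tuple size_w)) = (i (val x) * i a ^+ n.-1.-1 * i (val y))%g.
    by rewrite iF /= big_cons big_rcons /= prod_nseq mulgA.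
  have [c' cE] : exists c' : fset_set C, val c' = F (Tuple size_w).
    apply: toC; rewrite /e iF -(big_map i predT id).
    apply: (near_idem_prod_class m2 near) => // _ /mapP[v vw ->]; split => //.
    move: vw; rewrite /w in_cons mem_rcons in_cons mem_nseq.
    by case/or3P => [/eqP->|/eqP->|/andP[_ /eqP->]] //; apply: inC.
  by exists c'; rewrite /g cE iw !mulgA.
- move=> x y.
  have iCa (w : fset_set C) : commute (i (val w)) (i a) by apply: iC (inC w).
  have iCC : commute (i (val x)) (i (val y)) by apply: iC; rewrite !inC.
  have gC (w : fset_set C) v :
      commute (i (val w)) v -> commute (i a) v -> commute (g w) v.
    move=> wv av; apply/commute_sym/commuteM; first exact: commute_sym.
    exact/commuteX/commute_sym.
  by apply: (gC x); apply: commute_sym; apply: (gC y) => //; apply: commute_sym.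
- move=> x; rewrite gzE expgMn; last exact: commuteX (iC _ _ (inC x)).
  rewrite expgnAC -/(e a) -/(e _) inC.
  have ea : (e a * e a = e a)%g by rewrite (near_idem_mulXX m2 near).
  by elim: n.-1.-1 => [|k IH]; rewrite ?mulg1 // expgS mulgA ea.
Qed.

(** * From an Abelian group to an operation *)

(* Outside the image of the group, every element is a left zero, and it absorbs
   the group elements on both sides. *)
Section AdjoinLeftZeros.
Local Open Scope group_scope.
Variables (gT : finGroupType) (X : choiceType) (f : gT -> X).

Definition adjoin of injective f : Type := X.

Hypothesis f_inj : injective f.
Let preim_f (x : X) : option gT := [pick a | f a == x].

Let preim_fP x : (exists2 a, preim_f x = Some a & x = f a) \/
  (preim_f x = None /\ ~ range f x).
Proof.
rewrite /preim_f; case: pickP => [a /eqP <-|no]; first by left; exists a.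
by right; split=> // -[a _ ax]; have := no a; rewrite ax eqxx.
Qed.

Let preim_fK a : preim_f (f a) = Some a.
Proof.
by have [[b -> /f_inj->]|[_ []]] := preim_fP (f a); last by exists a.
Qed.

Let mul x y : X :=
  match preim_f x, preim_f y with
  | Some a, Some b => f (a * b)
  | Some _, None => y
  | None, _ => x
  end.

Let mulA : associative mul.
Proof.
move=> x y z; rewrite /mul.
case: (preim_fP x) => [[a xa _]|[xa _]]; rewrite xa ?xa //.
case: (preim_fP y) => [[b yb _]|[yb _]]; rewrite yb ?preim_fK ?xa ?yb //.
by case: (preim_fP z) => [[c zc _]|[zc _]]; rewrite zc ?preim_fK ?mulgA ?xa ?zc.
Qed.

Let mul1 : left_id (f 1) mul.
Proof.
move=> x; rewrite /mul preim_fK.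
by case: (preim_fP x) => [[a -> ->]|[-> _]]; rewrite ?mul1g.
Qed.

Let mulr1 : right_id (f 1) mul.
Proof.
move=> x; rewrite /mul preim_fK.
by case: (preim_fP x) => [[a -> ->]|[-> _]]; rewrite ?mulg1.
Qed.

HB.instance Definition _ := Choice.on (adjoin f_inj).
HB.instance Definition _ := isMonoid.Build (adjoin f_inj) mulA mul1 mulr1.

Definition to_adjoin (a : gT) : adjoin f_inj := f a.

Lemma to_adjoinM a b : to_adjoin (a * b) = to_adjoin a * to_adjoin b.
Proof. by rewrite [RHS]/mulg /= /mul !preim_fK. Qed.

Lemma to_adjoin_prod (v : seq gT) :
  \prod_(x <- map to_adjoin v) x = to_adjoin (\prod_(a <- v) a).
Proof. by rewrite big_map (big_morph _ to_adjoinM (erefl (to_adjoin 1))). Qed.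

(** The first letter outside the group absorbs everything around it; if there is none, the product
    stays in the group. *)
Lemma adjoin_prod (w : seq (adjoin f_inj)) :
  (\prod_(x <- w) x \in w /\ ~ range f (\prod_(x <- w) x)) \/
  exists v, w = map to_adjoin v.
Proof.
elim: w => [|x w IH]; first by right; exists [::].
rewrite big_cons; case: (preim_fP x) => [[a xa xE]|[xa xf]]; last first.
  by left; rewrite /mulg /= /mul xa mem_head.
case: IH => [[pw pf]|[v wE]]; last first.
  by right; exists (a :: v); rewrite wE /= xE.
left; suff -> : x * \prod_(y <- w) y = \prod_(y <- w) y by rewrite in_cons pw orbT.
case: (preim_fP (\prod_(y <- w) y)) => [[b _ pE]|[pb _]].
  by case: pf; rewrite pE; exists b.
by rewrite {1}/mulg /= /mul xa pb.
Qed.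

End AdjoinLeftZeros.

Lemma Fclass_setD_neq0 (gT : finGroupType) (X : choiceType) (f : gT -> X) n :
  2 < n -> injective f -> 2 < #|gT| -> (forall a b : gT, commute a b) ->
  (forall a : gT, a ^+ n.-1 = 1)%g -> (Fclass X n n.-1 `\` Fclass X n 1) !=set0.
Proof.
move=> n2 f_inj gT2 gC gX; have n0 : 0 < n by lia.
pose F (t : n.-tuple X) : X := (\prod_(x <- (t : seq (adjoin f_inj))) x)%g.
exists F; split; first split.
- exact: (@prod_associative (adjoin f_inj) n).
- move=> t [A cardA Aconst].
  have Fin : F t \in tval t -> exists i, F t = tnth t i.
    by case/tnthP => i E; exists i.
  have [[/Fin //]|[v tE]] := adjoin_prod (tval t : seq (adjoin f_inj)).
  have size_v : size v = n by rewrite -(size_map (to_adjoin f_inj)) -tE size_tuple.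
  have tvE (j : 'I_n) : tnth t j = f (nth 1%g v j).
    by rewrite (tnth_nth (f 1%g)) tE (nth_map 1%g) ?size_v.
  (* [j] is the index outside [A], or 0 if [A] contains every index. *)
  have [j jA] : exists j, forall l, l != j -> l \in A.
    have A1 : #|~: A| <= 1 by have := cardsC A; rewrite card_ord; lia.
    case: (set_0Vmem (~: A)) => [A0|[j jA]].
      by exists (Ordinal n0) => l _; move/setP/(_ l): A0; rewrite !inE => /negbFE.
    exists j => l; apply: contraNT => lA; apply/eqP.
    by apply/(card_le1_eqP A1); rewrite // inE.
  have [l0 l0A] : exists l0, l0 \in A by apply/card_gt0P; lia.
  pose c := nth 1%g v l0.
  have vE : v = nseq j c ++ nth 1%g v j :: nseq (n.-1 - j) c.
    apply: (@eq_from_nth _ 1%g) => [|l].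
      by rewrite size_cat /= !size_nseq size_v; have := ltn_ord j; lia.
    rewrite size_v => ln; pose l' := Ordinal ln.
    rewrite nth_cat size_nseq nth_nseq.
    have [<-|lj] := eqVneq l' j; first by rewrite ltnn subnn.
    have -> : nth 1%g v l = c.
      apply: (f_inj); rewrite -(tvE l') -(tvE l0).
      by apply: Aconst => //; apply: jA.
    case: ltnP => // jl.
    have {}lj : l != j :> nat by [].
    have -> : l - j = (l - j.+1).+1 by lia.
    by rewrite /= nth_nseq ifT //; lia.
  (* In the group, c^j d c^(m-j) = c^m d = d. *)
  exists j; rewrite tvE /F tE to_adjoin_prod; congr f.
  rewrite {1}vE big_cat big_cons !prod_nseq /= mulgA gC mulgA -expgnDr.
  by rewrite (_ : n.-1 - j + j = n.-1) ?gX ?mul1g //; have := ltn_ord j; lia.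
- case=> _ F1.
  have avoid (a b : gT) : exists c, c \notin [set a; b]%SET.
    have /card_gt0P[c] : 0 < #|~: [set a; b]%SET|.
      by move: gT2; rewrite -(cardsC [set a; b]%SET) cards2; case: eqP => _; lia.
    by rewrite inE => cab; exists c.
  (* With a distinct from 1 and b outside {1, a^-1}, the product ab differs from a, b and 1. *)
  have [a a1] := avoid 1%g 1%g; have [b ab1] := avoid 1%g (a^-1)%g.
  pose w := a :: b :: nseq n.-2 1%g.
  have size_w : size (map f w) == n by rewrite size_map /= size_nseq; lia.
  have [|j Fj] := F1 (Tuple size_w).
    exists [set Ordinal n0]%SET; first by rewrite cards1.
    by move=> i j; rewrite !inE => /eqP-> /eqP->.
  have FE : F (Tuple size_w) = f (a * b)%g.
    rewrite /F (to_adjoin_prod f_inj w) !big_cons (prod_nseq id) /=.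
    by rewrite expg1n mulg1.
  have : F (Tuple size_w) \in map f w by rewrite Fj; apply: mem_tnth.
  rewrite FE (mem_map f_inj) !in_cons mem_nseq.
  move: a1 ab1; rewrite !inE !negb_or => /andP[a1 _] /andP[b1 ba].
  case/or3P => [/eqP E|/eqP E|/andP[_ /eqP E]].
  - by rewrite -(inj_eq (mulgI a)) E mulg1 eqxx in b1.
  - by rewrite -(inj_eq (mulIg b)) E mul1g eqxx in a1.
  - by rewrite -(inj_eq (mulgI a)) E mulgV eqxx in ba.
Qed.

(** * Existence of operations compared with the cardinality of X *)

Theorem proposition1p10 (X : Type) (hX : `I_3 #<= [set: X]) (n : nat)
  (hn : 3 <= n) :
  (Fclass X n n.-1 `\` Fclass X n 1) !=set0 <->
  `I_(min_abelian_card n.-1) #<= [set: X].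
Proof.
have m2 : 1 < n.-1 by lia.
have [[gT [G [abG cardG G3 expG]]] minG] := min_abelian_cardP m2.
split=> [[F [Fn1 NF1]]|leX].
  (* An infinite X is at least as large as any [I_k]. *)
  have [Xfin|/infiniteP natX] := EM (finite_set [set: X]); last first.
    exact: card_le_trans (card_leT _) natX.
  have [k /minG le_k kX] := Fclass_abelian_exponent_card hn Xfin Fn1 NF1.
  by apply: card_le_trans kX; rewrite card_le_II.
elim/Pchoice: X => X in hX leX *.
(* A base point lets the cardinal inequality become a function on all of [nat], injective on the
   initial segment. *)
have [g g_inj] : exists g : nat -> X, {in `I_(min_abelian_card n.-1) &, injective g}.
  have [x0 _] : [set: X] !=set0.
    by apply/set0P/eqP => X0; move: hX; rewrite X0 card_le0 => /eqP/seteqP[/(_ 0 isT)].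
  pose pX : pointedType := HB.pack (Choice.sort X) (isPointed.Build (Choice.sort X) x0).
  exact: (@pcard_injP _ pX _ leX).
(* The subtype [subg_of G] makes the subgroup [G] a full group type. *)
have card_subgG : #|subg_of G| = min_abelian_card n.-1.
  by rewrite -cardG (card_isog (isog_subg G)) cardsT.
have ltG (a : subg_of G) : `I_(min_abelian_card n.-1) (enum_rank a).
  by rewrite -card_subgG /=.
apply: (@Fclass_setD_neq0 (subg_of G) X (fun a => g (enum_rank a))) => //.
- by move=> a b /g_inj; rewrite !inE => /(_ (ltG a) (ltG b)) /val_inj/enum_rank_inj.
- by rewrite card_subgG -cardG.
- by move=> a b; apply: subg_inj; apply: (centsP abG); apply: subgP.
- move=> a; apply: subg_inj.
  have -> : sgval (a ^+ n.-1)%g = (sgval a ^+ n.-1)%g.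
    by elim: n.-1 => // k IH; rewrite !expgS -IH.
  by rewrite (exponentP expG) ?subgP.
Qed.
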